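(* Let $n\ge1$ be an integer, $\gamma\in(0,1)$, and let $a,b>-1$ be real with $a+b\ne-1$. Then: (i) The zeros $\{{}_L\xi_i\}_{i=1}^n$ of ${}_{-1}I_x^\gamma P_n^{a,b}(x)$ other than the trivial zero $x=-1$ (that is, the $n$ zeros, listed with multiplicity, of the degree-$n$ polynomial $(1+x)^{-\gamma}\,{}_{-1}I_x^\gamma P_n^{a,b}(x)$) are eigenvalues of the $n\times n$ real matrix $S_L$ defined in the context. (ii) The zeros $\{{}_R\xi_i\}_{i=1}^n$ of ${}_{x}I_1^\gamma P_n^{a,b}(x)$ other than the trivial zero $x=1$ (that is, the $n$ zeros, listed with multiplicity, of the degree-$n$ polynomial $(1-x)^{-\gamma}\,{}_{x}I_1^\gamma P_n^{a,b}(x)$) are eigenvalues of the $n\times n$ real matrix $S_R$ defined in the context.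
   Context: $P_n^{a,b}$ is the classical Jacobi polynomial of degree $n$ on $[-1,1]$ with weight $(1-x)^a(1+x)^b$ and standard normalization $P_n^{a,b}(1)=\binom{n+a}{n}$. Here ${}_{-1}I_x^\gamma f(x)=\frac1{\Gamma(\gamma)}\int_{-1}^x\frac{f(\tau)}{(x-\tau)^{1-\gamma}}d\tau$ and ${}_xI_1^\gamma f(x)=\frac1{\Gamma(\gamma)}\int_x^1\frac{f(\tau)}{(\tau-x)^{1-\gamma}}d\tau$. Binomial coefficients with real upper entry are the generalized ones. For $2\le k\le n$ put $$\tilde a_k=\tfrac{(2k-1+a+b)(2k+a+b)}{2k(k+a+b)},\quad \tilde b_k=\tfrac{(b^2-a^2)(2k-1+a+b)}{2k(k+a+b)(2k-2+a+b)},\quad \tilde c_k=\tfrac{(k-1+a)(k-1+b)(2k+a+b)}{k(k+a+b)(2k-2+a+b)},$$ $$\bar a_k=\tfrac{-2(k-1+a)(k-1+b)}{(k-1+a+b)(2k-2+a+b)(2k-1+a+b)},\quad \bar b_k=\tfrac{2(a-b)}{(2k-2+a+b)(2k+a+b)},\quad \bar c_k=\tfrac{2(k+a+b)}{(2k-1+a+b)(2k+a+b)},$$ $$d_k^{L1}=(-1)^k\tbinom{k-2+b}{k-2},\quad d_k^{L2}=(-1)^{k-1}\tbinom{k-1+b}{k-1},\quad d_k^{L3}=(-1)^k\tbinom{k+b}{k},$$ $$d_k^{R1}=\tbinom{k-2+a}{k-2},\quad d_k^{R2}=\tbinom{k-1+a}{k-1},\quad d_k^{R3}=\tbinom{k+a}{k},$$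 $$A_k^1=\frac{\tilde a_k}{1+\gamma\tilde a_k\bar c_k},\quad A_k^2=\frac{\tilde b_k+\gamma\tilde a_k\bar b_k}{1+\gamma\tilde a_k\bar c_k},\quad A_k^3=\frac{\tilde c_k+\gamma\tilde a_k\bar a_k}{1+\gamma\tilde a_k\bar c_k},$$ $$A_k^{L4}=\frac{\gamma\tilde a_k(\bar a_kd_k^{L1}+\bar b_kd_k^{L2}+\bar c_kd_k^{L3})}{1+\gamma\tilde a_k\bar c_k},\quad A_k^{R4}=\frac{\gamma\tilde a_k(\bar a_kd_k^{R1}+\bar b_kd_k^{R2}+\bar c_kd_k^{R3})}{1+\gamma\tilde a_k\bar c_k}.$$ The matrix $S_L=(S_{L\,ij})_{1\le i,j\le n}$ has only the following possibly nonzero entries (main diagonal, first super- and subdiagonal, and first column), whenever the indices are in range; all other entries are $0$: $S_{L\,11}=\frac{b-a+2\gamma+2b\gamma}{a+b+2}$; $S_{L\,12}=\frac{2(1+\gamma)}{a+b+2}$; $S_{L\,kk}=\frac{A_k^2}{A_k^1}$ for $k=2,\dots,n$; $S_{L\,k,k+1}=\frac1{A_k^1}$ for $k=2,\dots,n-1$; $S_{L\,21}=\frac{A_2^3-A_2^{L4}}{A_2^1}$; $S_{L\,k+1,k}=\frac{A_{k+1}^3}{A_{k+1}^1}$ for $k=2,\dots,n-1$; $S_{L\,k1}=-\frac{A_k^{L4}}{A_k^1}$ for $k=3,\dots,n$. The matrix $S_R$ has the same form, with $S_{R\,11}=\frac{b-a-2\gamma-2a\gamma}{a+b+2}$; $S_{R\,12}=\frac{2(1+\gamma)}{a+b+2}$;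 $S_{R\,kk}=\frac{A_k^2}{A_k^1}$ for $k=2,\dots,n$; $S_{R\,k,k+1}=\frac1{A_k^1}$ for $k=2,\dots,n-1$; $S_{R\,21}=\frac{A_2^3-A_2^{R4}}{A_2^1}$; $S_{R\,k+1,k}=\frac{A_{k+1}^3}{A_{k+1}^1}$ for $k=2,\dots,n-1$; $S_{R\,k1}=-\frac{A_k^{R4}}{A_k^1}$ for $k=3,\dots,n$; all other entries $0$. *)

(* Defs.v *)
From HB Require Import structures.
From mathcomp Require Import all_boot all_order all_algebra.
From mathcomp Require Import complex.
From mathcomp Require Import all_classical all_reals all_analysis.

Set Implicit Arguments.
Unset Strict Implicit.
Unset Printing Implicit Defensive.

Import Order.TTheory GRing.Theory Num.Theory.
Import numFieldNormedType.Exports.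

Local Open Scope classical_set_scope.
Local Open Scope ring_scope.

(* Binomial coefficient with real upper entry: x (x-1) ... (x-k+1) / k! *)
Definition gbinom (R : realType) (x : R) (k : nat) : R :=
  (\prod_(j < k) (x - j%:R)) / (k`!)%:R.

(* Euler's integral; only used for positive arguments. *)
Definition Gamma (R : realType) (g : R) : R :=
  \int[@lebesgue_measure R]_(t in `]0, +oo[) (t `^ (g - 1) * expR (- t)).

Definition frac_int_left (R : realType) (g : R) (f : R -> R) (x : R) : R :=
  (Gamma g)^-1 *
  \int[@lebesgue_measure R]_(t in `]-1, x[) (f t / (x - t) `^ (1 - g)).

Definition frac_int_right (R : realType) (g : R) (f : R -> R) (x : R) : R :=
  (Gamma g)^-1 *
  \int[@lebesgue_measure R]_(t in `]x, 1[) (f t / (t - x) `^ (1 - g)).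

(* The classical Jacobi polynomial P_n^{a,b}: degree n, orthogonal on [-1, 1]
   to all polynomials of degree < n for the weight (1-x)^a (1+x)^b, and
   normalized at 1. For a, b > -1 these conditions determine P uniquely. *)
Definition is_jacobi (R : realType) (a b : R) (n : nat) (P : {poly R}) : Prop :=
  [/\ size P = n.+1,
      forall q : {poly R}, (size q <= n)%N ->
        \int[@lebesgue_measure R]_(x in `]-1, 1[)
          ((1 - x) `^ a * (1 + x) `^ b * (P.[x] * q.[x])) = 0
    & P.[1] = gbinom (n%:R + a) n].

(* xi lists the complex zeros of the real polynomial p with multiplicity. *)
Definition zero_list (R : realType) (n : nat) (p : {poly R})
    (xi : n.-tuple R[i]) : Prop :=
  map_poly (real_complex R) p =
    (real_complex R (lead_coef p)) *: \prod_(z <- xi) ('X - z%:P).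

Section Coefficients.
Variables (R : realType) (a b g : R).
Implicit Types k : nat.

Definition at_ k : R :=
  ((2 * k%:R - 1 + a + b) * (2 * k%:R + a + b)) / (2 * k%:R * (k%:R + a + b)).
Definition bt_ k : R :=
  ((b ^+ 2 - a ^+ 2) * (2 * k%:R - 1 + a + b)) /
  (2 * k%:R * (k%:R + a + b) * (2 * k%:R - 2 + a + b)).
Definition ct_ k : R :=
  ((k%:R - 1 + a) * (k%:R - 1 + b) * (2 * k%:R + a + b)) /
  (k%:R * (k%:R + a + b) * (2 * k%:R - 2 + a + b)).

Definition abar k : R :=
  (- 2 * (k%:R - 1 + a) * (k%:R - 1 + b)) /
  ((k%:R - 1 + a + b) * (2 * k%:R - 2 + a + b) * (2 * k%:R - 1 + a + b)).
Definition bbar k : R :=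
  (2 * (a - b)) / ((2 * k%:R - 2 + a + b) * (2 * k%:R + a + b)).
Definition cbar k : R :=
  (2 * (k%:R + a + b)) / ((2 * k%:R - 1 + a + b) * (2 * k%:R + a + b)).

Definition dL1 k : R := (-1) ^+ k * gbinom (k%:R - 2 + b) (k - 2)%N.
Definition dL2 k : R := (-1) ^+ (k - 1)%N * gbinom (k%:R - 1 + b) (k - 1)%N.
Definition dL3 k : R := (-1) ^+ k * gbinom (k%:R + b) k.

Definition dR1 k : R := gbinom (k%:R - 2 + a) (k - 2)%N.
Definition dR2 k : R := gbinom (k%:R - 1 + a) (k - 1)%N.
Definition dR3 k : R := gbinom (k%:R + a) k.

Definition A1 k : R := at_ k / (1 + g * at_ k * cbar k).
Definition A2 k : R := (bt_ k + g * at_ k * bbar k) / (1 + g * at_ k * cbar k).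
Definition A3 k : R := (ct_ k + g * at_ k * abar k) / (1 + g * at_ k * cbar k).
Definition AL4 k : R :=
  (g * at_ k * (abar k * dL1 k + bbar k * dL2 k + cbar k * dL3 k)) /
  (1 + g * at_ k * cbar k).
Definition AR4 k : R :=
  (g * at_ k * (abar k * dR1 k + bbar k * dR2 k + cbar k * dR3 k)) /
  (1 + g * at_ k * cbar k).

(* Entry (i, j), with indices starting from 1, of the common form of S_L and
   S_R; only the corner entry s11 and the sequence A4 differ. *)
Definition S_entry (s11 : R) (A4 : nat -> R) (i j : nat) : R :=
  if i == 1%N then
    if j == 1%N then s11
    else if j == 2%N then (2 * (1 + g)) / (a + b + 2)
    else 0
  else if j == 1%N then
    if i == 2%N then (A3 2%N - A4 2%N) / A1 2%N else - (A4 i / A1 i)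
  else if j == i then A2 i / A1 i
  else if j == i.+1 then 1 / A1 i
  else if i == j.+1 then A3 i / A1 i
  else 0.

Definition S_L n : 'M[R]_n :=
  \matrix_(i < n, j < n)
    S_entry ((b - a + 2 * g + 2 * b * g) / (a + b + 2)) AL4 i.+1 j.+1.

Definition S_R n : 'M[R]_n :=
  \matrix_(i < n, j < n)
    S_entry ((b - a - 2 * g - 2 * a * g) / (a + b + 2)) AR4 i.+1 j.+1.

End Coefficients.

(* Main.v *)
Require Import Defs.
From HB Require Import structures.
From mathcomp Require Import all_boot all_order all_algebra.
From mathcomp Require Import complex polyrcf ring lra.
From mathcomp Require Import all_classical all_reals all_analysis.
From mathcomp Require Import measurable_realfun.

Set Implicit Arguments.
Unset Strict Implicit.
Unset Printing Implicit Defensive.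

Import Order.TTheory GRing.Theory Num.Theory.
Import numFieldNormedType.Exports.

Local Open Scope classical_set_scope.
Local Open Scope ring_scope.

(** The proof treats both sides at once. For a polynomial p put
      (T p)(x) = int_0^1 p (x + (c - x) s) s^(g - 1) ds.
    For c = -1 (resp. c = 1) a change of variable shows that T p is Gamma g times
    (1 + x)^(-g) (resp. (1 - x)^(-g)) times the left (resp. right) fractional
    integral of p; algebraically T is [frac_poly], and the comparison is
    [frac_int_left_poly] and [frac_int_right_poly]. Integration by parts gives
    the commutation rule [frac_poly_mulX_deriv]
      T (x F') = x T F' + F(c) - g T F.

    Let P_k be the Jacobi polynomials and Q_k = T P_k. Since P_(k+1) is the
    derivative of a combination F of P_k, P_(k+1) and P_(k+2)
    ([jacobi_deriv_relation]), the rule turns the three-term recurrence of the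
    P_k into an expression of x Q_(k+1) through Q_(k+2), Q_(k+1), Q_k and Q_0
    ([frac_jacobi_recurrence]). The coefficients are the rows of the matrix: the
    boundary term F(c) accounts for the first column, and the known values of
    the P_k at c identify it with the left or the right matrix.

    Therefore the column v of Q_0, ..., Q_(n-1) satisfies
      (x - S) v = (0, ..., 0, const * Q_n),
    and, Q_0 being a nonzero constant, multiplication by the adjugate shows that
    the characteristic polynomial of S is Q_n divided by its leading coefficient
    ([char_poly_of_recurrence]). This equality of polynomials accounts for the
    multiplicities.

    It remains to know that the polynomial given by degree, orthogonality and
    value at 1 is the one given by the recurrence ([jacobi_poly_unique]). The
    weight enters only through Pearson's equation ([jacobi_int_pearson]), an
    instance of the fundamental theorem of calculus on an open interval
    ([integrable_FTC2_oo]), and through the positivity of the integral of p^2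
    ([jacobi_int_sqr_eq0]). Combined with the lowering relation
    [jacobi_structure], Pearson's equation shows that all P_k with k >= 1 have
    integral 0, which together with the recurrence is orthogonality. *)

(** * The fundamental theorem of calculus on open intervals *)

Section improper_FTC.
Variables (R : realType) (u v : R).
Hypothesis uv : u < v.
Local Notation mu := (@lebesgue_measure R).

(* The improper integral is exhausted by the compact intervals E n, whose
   distance h n to the endpoints decreases to 0; n.+3 gives each of them a
   positive length. *)
Let h (n : nat) : R := (v - u) / n.+3%:R.
Let E (n : nat) : set R := `[u + h n, v - h n].

Let h_gt0 n : 0 < h n.
Proof. by rewrite divr_gt0// subr_gt0. Qed.

Let h_lt n : u + h n < v - h n.
Proof.
rewrite -subr_gt0 (_ : _ - _ = (v - u) * (1 - 2 / n.+3%:R)); last first.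
  rewrite /h; have : n.+3%:R != 0 :> R by rewrite pnatr_eq0.
  by move: (n.+3%:R) => m m0; field.
rewrite mulr_gt0 ?subr_gt0// ltr_pdivrMr// mul1r ltr_nat.
by rewrite !ltnS.
Qed.

Let h_cvg0 : h n @[n --> \oo] --> (0 : R).
Proof.
rewrite -(mulr0 (v - u)); apply: cvgMr.
have := @cvg_harmonic R; rewrite -(@cvg_shiftn 2 R) /harmonic.
apply: cvg_trans; apply: near_eq_cvg; apply: nearW => n.
by rewrite /= ?addn2 ?add2n.
Qed.

Let h_ninc m n : (m <= n)%N -> h n <= h m.
Proof.
by move=> mn; rewrite ler_pM2l ?subr_gt0// lef_pV2 ?posrE// ler_nat !ltnS.
Qed.

Let E_nd : nondecreasing_seq E.
Proof.
move=> m n mn; apply/subsetPset => x; rewrite /E/= !in_itv/= => /andP[ux xv].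
have := h_ninc mn; lra.
Qed.

Let E_sub n : E n `<=` `]u, v[.
Proof. by move=> x; rewrite /E/= !in_itv/=; have := h_gt0 n; lra. Qed.

Let E_cover : \bigcup_n E n = `]u, v[%classic.
Proof.
apply/seteqP; split=> [x [n _]|x]; first exact: E_sub.
rewrite /= in_itv/= => /andP[ux xv].
have d0 : 0 < Num.min (x - u) (v - x) by rewrite lt_min !subr_gt0 ux.
have /cvgrPdist_lt/(_ _ d0)[N _ HN] := h_cvg0.
exists N => //; rewrite /E/= in_itv/=.
have := HN N (leqnn N); rewrite /= sub0r normrN gtr0_norm//.
by rewrite lt_min => /andP[]; lra.
Qed.

Variables f F : R -> R.
Hypothesis cf : {in `]u, v[, continuous f}.
Hypothesis dF : derivable_oo_LRcontinuous F u v.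
Hypothesis F'f : {in `]u, v[, F^`()%classic =1 f}.

Let mf : measurable_fun `]u, v[ f.
Proof.
apply: open_continuous_measurable_fun => // x; rewrite inE => xuv.
exact: cf.
Qed.

Let cF x : x \in `]u, v[ -> {for x, continuous F}.
Proof.
by move=> xuv; apply/differentiable_continuous/derivable1_diffP; case: dF => + _ _; exact.
Qed.

Let int_E n : (\int[mu]_(x in E n) (f x)%:E = (F (v - h n) - F (u + h n))%:E)%E.
Proof.
have sub x : x \in `[u + h n, v - h n] -> x \in `]u, v[.
  exact: (@E_sub n).
rewrite EFinB; apply: continuous_FTC2; first exact: h_lt.
- by apply: continuous_in_subspaceT => x; rewrite inE/= => /sub; exact: cf.
- split=> [x xE||].
  + by case: dF => + _ _; apply; apply: sub; apply: subset_itv_oo_cc.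
  + by apply: cvg_at_right_filter; apply: cF; apply: sub; rewrite in_itv/= lexx ltW.
  + by apply: cvg_at_left_filter; apply: cF; apply: sub; rewrite in_itv/= lexx ltW.
- by move=> x xE; apply: F'f; apply: sub; apply: subset_itv_oo_cc.
Qed.

Let cvg_FE : F (v - h n) - F (u + h n) @[n --> \oo] --> F v - F u.
Proof.
case: dF => _ Fu Fv; apply: cvgB.
- move/cvg_at_leftP: Fv; apply; split=> [n|]; first by have := h_gt0 n; lra.
  by rewrite -[X in _ --> X]subr0; apply: cvgB => //; exact: cvg_cst.
- move/cvg_at_rightP: Fu; apply; split=> [n|]; first by have := h_gt0 n; lra.
  by rewrite -[X in _ --> X]addr0; apply: cvgD => //; exact: cvg_cst.
Qed.

Let cvg_E (k : R -> R) : measurable_fun `]u, v[ k -> (forall x, 0 <= k x) ->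
  (\int[mu]_(x in E n) (k x)%:E @[n --> \oo] --> \int[mu]_(x in `]u, v[) (k x)%:E)%E.
Proof.
move=> mk k0; rewrite -E_cover; apply: ge0_nondecreasing_set_cvg_integral => //.
- by move=> n; exact: measurable_itv.
- by move=> n; apply/measurable_EFinP; apply: (measurable_funS _ _ mk).
- by move=> n x _; rewrite lee_fin.
Qed.

(** For a nonnegative derivative, monotone convergence along E n gives the
    integrability as well as the value, so that f may be unbounded at both
    endpoints. *)
Lemma ge0_FTC2_oo : {in `]u, v[, forall x, 0 <= f x} ->
  mu.-integrable `]u, v[ (EFin \o f) /\
  (\int[mu]_(x in `]u, v[) (f x)%:E = (F v - F u)%:E)%E.
Proof.
move=> f0.
suff H : (\int[mu]_(x in `]u, v[) (f x)%:E = (F v - F u)%:E)%E.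
  split=> //; apply/integrableP; split; first exact/measurable_EFinP.
  have -> : (\int[mu]_(x in `]u, v[) `|(EFin \o f) x| =
             \int[mu]_(x in `]u, v[) (f x)%:E)%E.
    by apply: eq_integral => x; rewrite inE/= => /f0 fx0; rewrite ger0_norm.
  by rewrite H ltry.
have fE (D : set R) : D `<=` `]u, v[ ->
    (\int[mu]_(x in D) (Num.max (f x) 0)%:E = \int[mu]_(x in D) (f x)%:E)%E.
  move=> Duv; apply: eq_integral => x; rewrite inE => /Duv /f0 fx0.
  by rewrite max_l.
have mk : measurable_fun `]u, v[ (fun x => Num.max (f x) 0).
  exact: measurable_funrpos.
have := @cvg_E _ mk (funrpos_ge0 f); rewrite fE// => fcvg.
apply/esym; move/cvg_lim : fcvg => <- //.
apply/esym/cvg_lim => //; under eq_cvg do rewrite fE// int_E.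
exact/cvg_EFin/cvg_FE/nearW.
Qed.

(** Without a sign, the positive and negative parts are treated separately,
    and integrability prevents the difference of two infinite limits. *)
Lemma integrable_FTC2_oo : mu.-integrable `]u, v[ (EFin \o f) ->
  \int[mu]_(x in `]u, v[) f x = F v - F u.
Proof.
move=> intf; apply: EFin_inj; rewrite /Rintegral fineK ?integrable_fin_num//.
have mEf : measurable_fun `]u, v[ (EFin \o f) by exact/measurable_EFinP.
have cp := @cvg_E f^\+ (measurable_funrpos mf) (funrpos_ge0 f).
have cn := @cvg_E f^\- (measurable_funrneg mf) (funrneg_ge0 f).
rewrite (_ : (fun x => (f x)%:E) = EFin \o f)// integralE.
rewrite funerpos funerneg.
have -> : ((F v - F u)%:E = \int[mu]_(x in `]u, v[) (f^\+ x)%:E -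
                           \int[mu]_(x in `]u, v[) (f^\- x)%:E)%E; last by [].
have fp : (\int[mu]_(x in `]u, v[) (f^\+ x)%:E)%E \is a fin_num.
  by have := integrable_pos_fin_num _ intf; rewrite funerpos; apply.
have cFE : (F (v - h n) - F (u + h n))%:E @[n --> \oo] --> (F v - F u)%:E.
  exact/cvg_EFin/cvg_FE/nearW.
have := cvgeB (fin_num_adde_defr _ _) cp cn => /(_ _ fp) cB.
move/cvg_lim : cFE => <- //; apply: cvg_lim => //.
apply: cvg_trans cB; apply: near_eq_cvg; apply: nearW => n.
rewrite -int_E [RHS]integralE.
by rewrite (_ : (fun x => (f x)%:E) = EFin \o f)// funerpos funerneg.
Qed.
End improper_FTC.

(** * Integrals of powers *)

Section powers.
Variable R : realType.
Implicit Types (x s t u v : R).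
Local Notation mu := (@lebesgue_measure R).

Lemma cvg_powR_sub_at_right x s : 0 < s ->
  (t - x) `^ s @[t --> x^'+] --> (0 : R).
Proof.
move=> s0; have /cvg_at_rightP H := powR_cvg0 s0.
apply/cvg_at_rightP => w [wx cw]; apply: (H (fun n => w n - x)); split=> [n|].
  by rewrite subr_gt0.
by rewrite -(subrr x); apply: cvgB => //; exact: cvg_cst.
Qed.

Lemma cvg_powR_sub_at_left x s : 0 < s ->
  (x - t) `^ s @[t --> x^'-] --> (0 : R).
Proof.
move=> s0; have /cvg_at_rightP H := powR_cvg0 s0.
apply/cvg_at_leftP => w [wx cw]; apply: (H (fun n => x - w n)); split=> [n|].
  by rewrite subr_gt0.
by rewrite -(subrr x); apply: cvgB => //; exact: cvg_cst.
Qed.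

Lemma is_derive_powR_subr x s t : x < t ->
  is_derive t 1 (fun t => (t - x) `^ s) (s * (t - x) `^ (s - 1)).
Proof.
rewrite -subr_gt0 => xt.
have dg : is_derive t 1 (fun t => t - x) 1.
  by rewrite -[X in is_derive _ _ _ X]subr0; apply: is_deriveB.
by have := @is_derive1_comp R (@powR R ^~ s) _ t _ _ (is_derive1_powR s xt) dg; rewrite mulr1.
Qed.

Lemma is_derive_powR_subl x s t : t < x ->
  is_derive t 1 (fun t => (x - t) `^ s) (- (s * (x - t) `^ (s - 1))).
Proof.
rewrite -subr_gt0 => xt.
have dg : is_derive t 1 (fun t => x - t) (-1).
  by rewrite -[X in is_derive _ _ _ X]sub0r; apply: is_deriveB.
by have := @is_derive1_comp R (@powR R ^~ s) _ t _ _ (is_derive1_powR s xt) dg; rewrite mulrN1.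
Qed.

Lemma is_derive_continuous (f : R -> R) t (df : R) :
  is_derive t 1 f df -> {for t, continuous f}.
Proof.
by move=> H; apply/differentiable_continuous/derivable1_diffP; exact: ex_derive.
Qed.

(** The exponent s - 1 may lie in ]-1, 0[: the antiderivative vanishes
    continuously at the singular endpoint because s is positive. *)
Lemma FTC_powR_subr x s v : 0 < s -> x < v ->
  mu.-integrable `]x, v[ (EFin \o (fun t => (t - x) `^ (s - 1))) /\
  \int[mu]_(t in `]x, v[) ((t - x) `^ (s - 1)) = (v - x) `^ s / s.
Proof.
move=> s0 xv; have s1 : s != 0 by rewrite gt_eqF.
have dF t : x < t -> is_derive t 1 (fun t => s^-1 * (t - x) `^ s)
    ((t - x) `^ (s - 1)).
  move=> xt; have := @is_deriveZ _ _ _ _ s^-1 _ _ _ (is_derive_powR_subr s xt).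
  by rewrite /= scalerA mulVf// scale1r.
have [||||H1 H2] := @ge0_FTC2_oo R x v xv (fun t => (t - x) `^ (s - 1))
   (fun t => s^-1 * (t - x) `^ s).
- move=> t; rewrite in_itv/= => /andP[xt _].
  exact: is_derive_continuous (is_derive_powR_subr _ xt).
- split=> [t||].
  + by rewrite in_itv/= => /andP[xt _]; have := dF _ xt => /@ex_derive.
  + rewrite subrr powR0// mulr0 -(mulr0 s^-1); apply: cvgMr.
    exact: cvg_powR_sub_at_right.
  + by apply: cvg_at_left_filter; exact: (is_derive_continuous (dF _ xv)).
- move=> t; rewrite in_itv/= => /andP[xt _]; rewrite derive1E.
  by have := dF _ xt => H; exact: derive_val.
- by move=> t _; exact: powR_ge0.
- split=> //; rewrite /Rintegral H2/= subrr powR0// mulr0 subr0 mulrC//.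
Qed.

Lemma FTC_powR_subl x s u : 0 < s -> u < x ->
  mu.-integrable `]u, x[ (EFin \o (fun t => (x - t) `^ (s - 1))) /\
  \int[mu]_(t in `]u, x[) ((x - t) `^ (s - 1)) = (x - u) `^ s / s.
Proof.
move=> s0 ux; have s1 : s != 0 by rewrite gt_eqF.
have dF t : t < x -> is_derive t 1 (fun t => - s^-1 * (x - t) `^ s)
    ((x - t) `^ (s - 1)).
  move=> xt; have := @is_deriveZ _ _ _ _ (- s^-1) _ _ _ (is_derive_powR_subl s xt).
  by rewrite /= scalerN scaleNr opprK scalerA mulVf// scale1r.
have [||||H1 H2] := @ge0_FTC2_oo R u x ux (fun t => (x - t) `^ (s - 1))
   (fun t => - s^-1 * (x - t) `^ s).
- move=> t; rewrite in_itv/= => /andP[_ tx].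
  exact: is_derive_continuous (is_derive_powR_subl _ tx).
- split=> [t||].
  + by rewrite in_itv/= => /andP[_ tx]; have := dF _ tx => /@ex_derive.
  + by apply: cvg_at_right_filter; exact: (is_derive_continuous (dF _ ux)).
  + rewrite subrr powR0// mulr0 -(mulr0 (- s^-1)); apply: cvgMr.
    exact: cvg_powR_sub_at_left.
- move=> t; rewrite in_itv/= => /andP[_ tx]; rewrite derive1E.
  by have := dF _ tx => H; exact: derive_val.
- by move=> t _; exact: powR_ge0.
- by split=> //; rewrite /Rintegral H2/= subrr powR0// mulr0 sub0r mulNr opprK mulrC.
Qed.

End powers.

(** * Null sets and Euler's integral *)

Section Gamma_and_null.
Variable R : realType.
Local Notation mu := (@lebesgue_measure R).

(** A nonnegative integrand with integral 0 vanishes almost everywhere; if it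
    has only countably many zeros in D, this makes D itself null. It yields both
    that Euler's integral is nonzero and that the Jacobi form is definite. *)
Lemma Rintegral0_null (D : set R) (f : R -> R) : measurable D ->
  mu.-integrable D (EFin \o f) -> (forall x, D x -> 0 <= f x) ->
  countable (D `&` [set x | f x = 0]) -> \int[mu]_(x in D) f x = 0 -> mu D = 0%E.
Proof.
move=> mD intf f0 cf0 /eqP; rewrite -eqe /Rintegral fineK ?integrable_fin_num//.
move=> /eqP If0; have mf := measurable_int _ intf.
have /(ae_eq_integral_abs mu mD mf) [N [mN N0 sN]] :
    (\int[mu]_(x in D) `|(EFin \o f) x| = 0)%E.
  rewrite -[RHS]If0; apply: eq_integral => x; rewrite inE => /f0 fx0 /=.
  by rewrite ger0_norm.
have mf0 : measurable (D `&` [set x | f x = 0]).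
  by apply: countable_measurable => // t; exact: measurable_set1.
apply/eqP; rewrite -measure_le0.
apply: (@le_trans _ _ (mu (N `|` (D `&` [set x | f x = 0])))).
  apply: le_measure; rewrite ?inE//; first exact: measurableU.
  move=> x Dx; have [fx0|fx0] := pselect (f x = 0); first by right.
  by left; apply: sN => /= /(_ Dx) /= [].
have U2 := @measureU2 _ _ _ mu _ _ mN mf0; apply: le_trans U2 _.
rewrite [X in (X + _)%E]N0 add0e [leLHS](countable_lebesgue_measure0 cf0).
exact: lexx.
Qed.

(** The integrand is dominated by the power t ^ (g - 1) on ]0, 1[ and by the
    exponential density elsewhere. *)
Lemma integrable_Gamma (g : R) : 0 < g <= 1 ->
  mu.-integrable `]0, +oo[ (EFin \o (fun t => t `^ (g - 1) * expR (- t))).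
Proof.
move=> /andP[g0 g1].
pose p t := t `^ (g - 1).
have i1 : mu.-integrable `]0, +oo[ (EFin \o (p \_ `]0, 1[)).
  have [+ _] := @FTC_powR_subr R 0 g 1 g0 ltr01.
  rewrite (_ : (fun t => (t - 0) `^ (g - 1)) = p) => [ip|]; last first.
    by apply/funext => t; rewrite subr0.
  rewrite -restrict_EFin; apply/integrable_restrict => //.
  rewrite setIidr// => t; rewrite /= !in_itv/= => /andP[->//].
have i2 : mu.-integrable `]0, +oo[ (EFin \o exponential_pdf 1).
  exact: integrableS (@integrable_exponential_pdf R 1 ltr01).
have iB : mu.-integrable `]0, +oo[
    ((EFin \o (p \_ `]0, 1[)) \+ (EFin \o exponential_pdf 1)).
  exact: integrableD.
apply: le_integrable iB => //.
  apply/measurable_EFinP/measurable_funTS/measurable_funM.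
    exact: measurable_powR.
  by apply: measurableT_comp => //; exact: measurableT_comp.
move=> t; rewrite /= in_itv/= andbT => t0; rewrite lee_fin patchE.
rewrite ger0_norm ?mulr_ge0 ?powR_ge0 ?expR_ge0//.
rewrite ger0_norm; last first.
  by rewrite addr_ge0 ?exponential_pdf_ge0//; case: ifP => // _; exact: powR_ge0.
case: ifPn => [_|]; last rewrite notin_setE/= in_itv/= t0/= => /negP.
- rewrite -[leLHS]addr0 lerD ?exponential_pdf_ge0//.
  by rewrite ler_piMr ?powR_ge0// -expR0 ler_expR oppr_le0 ltW.
- rewrite -leNgt => t1; rewrite add0r (exponential_pdfE _ (ltW t0)).
  rewrite mul1r mulN1r ler_piMl ?expR_ge0//.
  by rewrite -[leRHS](powRr0 t) ler_powR// subr_le0.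
Qed.

Lemma Gamma_neq0 (g : R) : 0 < g <= 1 -> Gamma g != 0.
Proof.
move=> g01; apply/eqP => G0.
suff : mu `]0%R, +oo[%classic = 0%E by rewrite lebesgue_measure_itv/= ltry.
apply: (@Rintegral0_null _ (fun t => t `^ (g - 1) * expR (- t))) => //.
- exact: integrable_Gamma.
- by move=> x _; rewrite mulr_ge0 ?powR_ge0 ?expR_ge0.
- rewrite (_ : _ `&` _ = set0); first exact: countable0.
  rewrite -subset0 => t [] /=; rewrite in_itv/= andbT => t0 /eqP.
  by rewrite gt_eqF// mulr_gt0 ?expR_gt0// powR_gt0.
Qed.
End Gamma_and_null.

(** * Integration against the Jacobi weight *)

Lemma powR_le_powR2 (R : realType) (c y : R) : 1 <= y <= 2 -> y `^ c <= 2 `^ `|c|.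
Proof.
move=> /andP[y1 y2]; apply: (@le_trans _ _ (y `^ `|c|)).
  by rewrite ler_powR// ler_norm.
by apply: ge0_ler_powR; rewrite ?nnegrE//; lra.
Qed.

Section jacobi_functional.
Variables (R : realType) (a b : R).
Hypotheses (ha : -1 < a) (hb : -1 < b).
Local Notation mu := (@lebesgue_measure R).

Local Notation w := (fun x : R => (1 - x) `^ a * (1 + x) `^ b).

(* Each factor of the weight is bounded on the half of the interval that is far
   from its own singularity. *)
Let integrable_w : mu.-integrable `]-1, 1[ (EFin \o w).
Proof.
have b1 : 0 < b + 1 by move: hb; lra.
have a1 : 0 < a + 1 by move: ha; lra.
have N11 : -1 < 1 :> R by lra.
have [i1 _] := FTC_powR_subr b1 N11.
have [i2 _] := FTC_powR_subl a1 N11.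
have iB := integrableD _ (integrableZl _ (2 `^ `|a|) i1) (integrableZl _ (2 `^ `|b|) i2).
apply: le_integrable (iB _ _ _) => //.
  apply/measurable_EFinP/measurable_funTS/measurable_funM.
    by apply: (@measurableT_comp _ _ _ _ _ _ (@powR R ^~ a)) => //; exact: measurable_funB.
  by apply: (@measurableT_comp _ _ _ _ _ _ (@powR R ^~ b)) => //; exact: measurable_funD.
move=> x; rewrite /= in_itv/= => /andP[x1 x2]; rewrite lee_fin.
rewrite !addrK opprK (addrC x).
have p1 := powR_ge0 (1 - x) a; have p2 := powR_ge0 (1 + x) b.
have p3 := powR_ge0 2 `|a|; have p4 := powR_ge0 2 `|b|.
rewrite (ger0_norm (mulr_ge0 p1 p2)) [leRHS]ger0_norm ?addr_ge0 ?mulr_ge0//.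
have [x0|x0] := leP x 0.
  have h1 : (1 - x) `^ a <= 2 `^ `|a| by apply: powR_le_powR2; apply/andP; split; lra.
  by apply: ler_wpDr; [exact: mulr_ge0|exact: ler_wpM2r].
have h1 : (1 + x) `^ b <= 2 `^ `|b| by apply: powR_le_powR2; apply/andP; split; lra.
by apply: ler_wpDl; [exact: mulr_ge0|rewrite mulrC; exact: ler_wpM2r].
Qed.

Let integrable_wpoly (q : {poly R}) :
  mu.-integrable `]-1, 1[ (EFin \o (fun x => w x * q.[x])).
Proof.
apply: (integrableMl _ integrable_w) => //; first exact: measurable_poly.
have [M HM] := poly_itv_bound q (-1) 1; exists M; split; first exact: num_real.
move=> N MN x; rewrite /= in_itv/= => /andP[x1 x2].
by apply: le_trans (ltW MN); apply: HM; rewrite !ltW.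
Qed.

Definition jacobi_int (q : {poly R}) : R :=
  \int[mu]_(x in `]-1, 1[) ((1 - x) `^ a * (1 + x) `^ b * q.[x]).

Lemma jacobi_intD (p q : {poly R}) : jacobi_int (p + q) = jacobi_int p + jacobi_int q.
Proof.
rewrite /jacobi_int -RintegralD//; [|exact: integrable_wpoly..].
by apply: eq_Rintegral => x _; rewrite hornerD mulrDr.
Qed.

Lemma jacobi_intZ c (p : {poly R}) : jacobi_int (c *: p) = c * jacobi_int p.
Proof.
rewrite /jacobi_int -RintegralZl//.
by apply: eq_Rintegral => x _; rewrite hornerZ mulrCA.
Qed.

Lemma jacobi_int_sqr_eq0 (p : {poly R}) : jacobi_int (p * p) = 0 -> p = 0.
Proof.
move=> I0; apply/eqP/negPn/negP => p0.
have : mu `]-1, 1[%classic = 0%E.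
  apply: (@Rintegral0_null _ _ (fun x => w x * (p * p).[x])) => //.
  - by move=> x _; rewrite hornerM -expr2 mulr_ge0 ?sqr_ge0// mulr_ge0 ?powR_ge0.
  - apply: (@sub_countable _ _ _ [set` rootsR p]); last first.
      exact/finite_set_countable/(finite_seq (rootsR p)).
    apply: subset_card_le => x [] /=; rewrite in_itv/= => /andP[x1 x2] /eqP.
    rewrite hornerM !mulf_eq0 !powR_eq0 orbb => px0.
    apply: (root_roots_on (roots_on_rootsR p0)) => //.
    by case/orP: px0 => // /orP[] /andP[/eqP]; lra.
by rewrite lebesgue_measure_itv/= lte_fin ifT; [rewrite -EFinD => -[]; lra|lra].
Qed.

(** Pearson's equation: the argument of the functional, times the weight, is
    the derivative of (1 - x)^(a+1) (1 + x)^(b+1) q(x), which vanishes at both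
    endpoints. The orthogonality of the Jacobi polynomials is derived from this
    equation alone. *)
Lemma jacobi_int_pearson (q : {poly R}) :
  jacobi_int ((1 - 'X^2) * q^`() + ((b - a)%:P - (a + b + 2) *: 'X) * q) = 0.
Proof.
have b1 : 0 < b + 1 by move: hb; lra.
have a1 : 0 < a + 1 by move: ha; lra.
have N11 : -1 < 1 :> R by lra.
pose u x : R := (1 - x) `^ (a + 1); pose v x : R := (x - -1) `^ (b + 1).
pose F : R -> R := (u * v) * horner q.
pose r := (1 - 'X^2) * q^`() + ((b - a)%:P - (a + b + 2) *: 'X) * q.
have dF (x : R) : -1 < x < 1 -> is_derive x 1 F
   ((1 - x) `^ a * (1 + x) `^ b * r.[x]).
  move=> /andP[x1 x2].
  have du : is_derive x 1 u _ := is_derive_powR_subl (a + 1) x2.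
  have dv : is_derive x 1 v _ := is_derive_powR_subr (b + 1) x1.
  have dq := is_derive_poly q x.
  have := @is_deriveM _ _ (u * v) (horner q) x 1 _ _ (is_deriveM du dv) dq.
  move=> /is_derive_eq; apply.
  have eu : u x = (1 - x) * (1 - x) `^ a.
    by rewrite /u -(@mulr_powRB1 _ _ (a + 1)) ?addrK//; lra.
  have ev : v x = (x - -1) * (x - -1) `^ b.
    by rewrite /v -(@mulr_powRB1 _ _ (b + 1)) ?addrK//; lra.
  have rE : r.[x] = (1 - x ^+ 2) * q^`().[x] + (b - a - (a + b + 2) * x) * q.[x].
    by rewrite /r hornerD !hornerM !hornerD !hornerN hornerXn hornerZ hornerX !hornerC.
  have uvE : (u * v) x = u x * v x by [].
  have sc (c d : R) : c *: (d : R^o) = c * d by [].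
  by rewrite !sc uvE eu ev rE !addrK opprK (addrC x 1); ring.
have -> : jacobi_int r = F 1 - F (-1).
  apply: (@integrable_FTC2_oo R (-1) 1 N11 _ F _ _ _ (integrable_wpoly r)).
  - move=> x; rewrite in_itv/= => /andP[x1 x2].
    have ca : {for x, continuous (fun t : R => (1 - t) `^ a)}.
      exact: is_derive_continuous (is_derive_powR_subl _ x2).
    have cb : {for x, continuous (fun t : R => (1 + t) `^ b)}.
      have := is_derive_continuous (is_derive_powR_subr b x1).
      rewrite (_ : (fun t : R => (t - -1) `^ b) = (fun t => (1 + t) `^ b))//.
      by apply/funext => t; rewrite opprK addrC.
    exact: (continuousM (continuousM ca cb) (@continuous_horner _ r x)).
  - split=> [x||].
    + by rewrite in_itv/= => /dF/@ex_derive.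
    + rewrite [F (-1)]/(u (-1) * v (-1) * q.[-1]).
      apply: cvgM; last by apply: cvg_at_right_filter; exact: continuous_horner.
      apply: cvgM.
        by apply: cvg_at_right_filter; exact: is_derive_continuous (is_derive_powR_subl _ N11).
      rewrite /v subrr powR0 ?gt_eqF//; exact: cvg_powR_sub_at_right.
    + rewrite [F 1]/(u 1 * v 1 * q.[1]).
      apply: cvgM; last by apply: cvg_at_left_filter; exact: continuous_horner.
      apply: cvgM; last first.
        by apply: cvg_at_left_filter; exact: is_derive_continuous (is_derive_powR_subr _ N11).
      rewrite /u subrr powR0 ?gt_eqF//; exact: cvg_powR_sub_at_left.
  - move=> x; rewrite in_itv/= derive1E => /dF dFx; exact: derive_val.
have FE x : F x = u x * v x * q.[x] by [].
by rewrite !FE /u /v !subrr !powR0 ?gt_eqF// !(mul0r, mulr0) subrr.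
Qed.

End jacobi_functional.

(** * Polynomials *)

Section polynomial_helpers.
Variable R : numDomainType.
Implicit Types p q : {poly R}.

(** Reduces identities between polynomials to identities between their values,
    where the decision procedure for fields applies. *)
Lemma poly_eq_horner p q : (forall x, p.[x] = q.[x]) -> p = q.
Proof.
move=> pq; apply/eqP; rewrite -subr_eq0; apply/negPn/negP => d0.
pose s := [seq i%:R : R | i <- iota 0 (size (p - q))].
have : (size s < size (p - q)%R)%N.
  apply: max_poly_roots => //.
    by apply/allP => x _; rewrite /root hornerD hornerN pq subrr.
  by rewrite map_inj_uniq ?iota_uniq// => i j /eqP; rewrite eqr_nat => /eqP.
by rewrite size_map size_iota ltnn.
Qed.

Lemma nderivn_deriv p j : p^`()^`N(j) = p^`N(j.+1) *+ j.+1.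
Proof.
apply/polyP => i; rewrite coef_nderivn coef_deriv coefMn coef_nderivn.
rewrite -!mulrnA addSn; congr (_ *+ _).
by rewrite [RHS]mulnC -mul_bin_diag.
Qed.

End polynomial_helpers.

(** Degree count shared by the recurrence of the Jacobi polynomials and that
    of their fractional integrals. *)
Lemma size_three_term (R : idomainType) (p q : {poly R}) k (al : R) : al != 0 ->
  size p = k.+1 -> (size q <= k.+1)%N -> size (al *: ('X * p) + q) = k.+2.
Proof.
move=> al0 sp sq.
have sXp : size (al *: ('X * p)) = k.+2.
  by rewrite size_scale// mulrC size_mulX ?sp// -size_poly_gt0 sp.
by rewrite size_polyDl ?sXp.
Qed.

(** * The fractional integral as an operator on polynomials *)

Section fractional_operator.
Variables (R : numFieldType) (c g : R).
Hypothesis g0 : 0 < g.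
Implicit Types p q F : {poly R}.

(** Termwise Taylor expansion of
      int_0^1 p (x + (c - x) s) s^(g - 1) ds
    around s = 0. With c = -1 (resp. c = 1) this is the left (resp. right)
    fractional integral of p without the factors 1 / Gamma g and
    (1 + x)^g (resp. (1 - x)^g), so that one operator serves both sides. *)
Definition frac_poly p : {poly R} :=
  \sum_(j < size p) (j%:R + g)^-1 *: ((c%:P - 'X) ^+ j * p^`N(j)).

Let jg (j : nat) : j%:R + g != 0.
Proof. by rewrite gt_eqF// ltr_wpDl. Qed.

Lemma frac_poly_wide n p : (size p <= n)%N ->
  frac_poly p = \sum_(j < n) (j%:R + g)^-1 *: ((c%:P - 'X) ^+ j * p^`N(j)).
Proof.
move=> pn; pose t j := (j%:R + g)^-1 *: ((c%:P - 'X) ^+ j * p^`N(j)).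
rewrite /frac_poly (big_ord_widen n t pn) big_mkcond/=.
apply: eq_bigr => j _; case: ifPn => //; rewrite -leqNgt => pj.
by rewrite nderivn_poly0// mulr0 scaler0.
Qed.

Lemma frac_poly_is_linear : linear frac_poly.
Proof.
move=> k p q; pose n := maxn (size p) (size q).
rewrite !(@frac_poly_wide n) ?leq_maxl ?leq_maxr//; last first.
  apply: leq_trans (size_polyD _ _) _; rewrite geq_max leq_maxr andbT.
  by apply: leq_trans (size_scale_leq _ _) _; exact: leq_maxl.
rewrite scaler_sumr -big_split/=; apply: eq_bigr => j _.
rewrite nderivnD nderivnZ mulrDr scalerDr -scalerAr !scalerA.
by rewrite mulrC.
Qed.

HB.instance Definition _ :=
  GRing.isLinear.Build R {poly R} {poly R} _ frac_poly frac_poly_is_linear.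

Lemma frac_poly1 : frac_poly 1 = g^-1%:P.
Proof.
by rewrite /frac_poly size_poly1 big_ord1 expr0 nderivn0 mulr1 add0r alg_polyC.
Qed.

(** In the integral form, x + (c - x) s times F' is x F' plus (c - x) s F', and
    the second part integrates by parts in s: it contributes F(c) - g T F.
    On coefficients this is the identity j / (j + g) = 1 - g / (j + g) together
    with Taylor's formula for F(c). *)
Lemma frac_poly_mulX_deriv F :
  frac_poly ('X * F^`()) = 'X * frac_poly F^`() + F.[c]%:P - g *: frac_poly F.
Proof.
pose n := (size F).+1.
have sF : (size F <= n)%N by exact: leqnSn.
have sF' : (size F^`() <= size F)%N.
  by have [->|/lt_size_deriv/ltnW//] := eqVneq F 0; rewrite deriv0.
have sXF' : (size ('X * F^`())%R <= n)%N.
  by apply: leq_trans (size_polyMleq _ _) _; rewrite size_polyX addSn add1n.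
rewrite (frac_poly_wide sXF') (frac_poly_wide sF) (frac_poly_wide (leq_trans sF' sF)).
have taylor : F.[c]%:P = \sum_(j < n) (c%:P - 'X) ^+ j * F^`N(j).
  apply: poly_eq_horner => x; rewrite hornerC horner_sum.
  rewrite -[c in LHS](subrKC x) (nderiv_taylor_wide (mulrC _ _) sF).
  by apply: eq_bigr => j _; rewrite hornerM horner_exp !hornerE mulrC.
rewrite taylor mulr_sumr scaler_sumr -big_split/= -sumrB.
apply: eq_bigr => -[[|j] jn] _ /=.
  rewrite !nderivn0 !expr0 !mul1r add0r scalerA divff ?gt_eqF// scale1r addrK.
  by rewrite -scalerAr.
have -> : ('X * F^`())^`N(j.+1) = F^`N(j.+1) *+ j.+1 + F^`()^`N(j.+1) * 'X.
  by rewrite -nderivn_deriv -(nderivnMXaddC _ _ 0) addr0 mulrC.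
rewrite mulrDr scalerDr mulrA [_ * 'X]mulrC scalerAr -addrA addrC; congr (_ + _).
  rewrite -scalerAr mulrnAr -[X in _ *: X = _]scaler_nat !scalerA.
  rewrite -[X in _ = X - _]scale1r -scalerBl; congr (_ *: _).
  by have := jg j.+1; move: (j.+1%:R) => m m0; field.
by rewrite -scalerAr.
Qed.

End fractional_operator.

Lemma Rintegral_lincomb d (T : measurableType d) (R : realType)
    (mu : {measure set T -> \bar R}) (D : set T) n (c : nat -> R)
    (f : nat -> T -> R) :
  measurable D -> (forall j, mu.-integrable D (EFin \o f j)) ->
  mu.-integrable D (EFin \o (fun x => \sum_(j < n) c j * f j x)) /\
  \int[mu]_(x in D) (\sum_(j < n) c j * f j x) =
  \sum_(j < n) c j * \int[mu]_(x in D) f j x.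
Proof.
move=> mD intf; elim: n => [|n [IHi IHe]].
  rewrite big_ord0; split.
    rewrite (_ : EFin \o _ = cst 0%E); first exact: integrable0.
    by apply/funext => x /=; rewrite big_ord0.
  rewrite (@eq_Rintegral _ _ _ _ _ (cst 0)) ?Rintegral_cst ?mul0r// => x _.
  by rewrite big_ord0.
have intc : mu.-integrable D (EFin \o (fun x => c n * f n x)).
  exact: (integrableZl mD (c n) (intf n)).
split.
  rewrite (_ : EFin \o _ = (EFin \o (fun x => \sum_(j < n) c j * f j x)) \+
     (EFin \o (fun x => c n * f n x))); first exact: integrableD.
  by apply/funext => x /=; rewrite big_ord_recr.
rewrite big_ord_recr/= -IHe -RintegralZl// -RintegralD//.
by apply: eq_Rintegral => x _; rewrite big_ord_recr.
Qed.

Section fractional_integral_of_polynomial.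
Variable R : realType.
Local Notation mu := (@lebesgue_measure R).

Lemma horner_taylor (p : {poly R}) x t :
  p.[t] = \sum_(j < size p) p^`N(j).[x] * (t - x) ^+ j.
Proof. by rewrite -nderiv_taylor ?subrKC//; exact: mulrC. Qed.

Let powR_split (y g : R) (j : nat) : 0 < y ->
  y ^+ j / y `^ (1 - g) = y `^ (j%:R + g - 1).
Proof.
move=> y0; rewrite -powR_mulrn ?ltW// -powRN -powRD; last first.
  by apply/implyP => _; rewrite gt_eqF.
by congr (_ `^ _); ring.
Qed.

Let jg (g : R) (j : nat) : 0 < g -> 0 < j%:R + g.
Proof. by move=> g0; rewrite ltr_wpDl. Qed.

(** p is expanded at x in powers of t - x, and each power is integrated against
    the kernel in closed form. *)
Lemma frac_int_left_poly (g x : R) (p : {poly R}) : 0 < g -> -1 < x ->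
  frac_int_left g (horner p) x =
  (Gamma g)^-1 * ((1 + x) `^ g * (frac_poly (-1) g p).[x]).
Proof.
move=> g0 x1; congr (_ * _).
have intf j := (FTC_powR_subl (@jg g j g0) x1).1.
have intE j := (FTC_powR_subl (@jg g j g0) x1).2.
pose c j := p^`N(j).[x] * (-1) ^+ j.
transitivity (\int[mu]_(t in `]-1, x[)
    (\sum_(j < size p) c j * (x - t) `^ (j%:R + g - 1))).
  apply: eq_Rintegral => t; rewrite inE/= in_itv/= => /andP[_ tx].
  rewrite (horner_taylor p x) mulr_suml; apply: eq_bigr => j _.
  by rewrite -powR_split ?subr_gt0// /c -(opprB x t) [(- (x - t)) ^+ j]exprNn !mulrA.
have [//|_ ->] := @Rintegral_lincomb _ _ _ mu _ (size p) c _ _ intf.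
rewrite /frac_poly horner_sum mulr_sumr; apply: eq_bigr => j _.
rewrite intE opprK (addrC x) powRD; last first.
  by apply/implyP => _; rewrite gt_eqF//; move: x1; lra.
rewrite powR_mulrn; last by move: x1; lra.
rewrite hornerZ hornerM horner_exp hornerD hornerN hornerX hornerC /c.
rewrite (_ : -1 - x = - (1 + x)); last by ring.
rewrite [(- (1 + x)) ^+ j]exprNn; ring.
Qed.

Lemma frac_int_right_poly (g x : R) (p : {poly R}) : 0 < g -> x < 1 ->
  frac_int_right g (horner p) x =
  (Gamma g)^-1 * ((1 - x) `^ g * (frac_poly 1 g p).[x]).
Proof.
move=> g0 x1; congr (_ * _).
have intf j := (FTC_powR_subr (@jg g j g0) x1).1.
have intE j := (FTC_powR_subr (@jg g j g0) x1).2.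
pose c j := p^`N(j).[x].
transitivity (\int[mu]_(t in `]x, 1[)
    (\sum_(j < size p) c j * (t - x) `^ (j%:R + g - 1))).
  apply: eq_Rintegral => t; rewrite inE/= in_itv/= => /andP[tx _].
  rewrite (horner_taylor p x) mulr_suml; apply: eq_bigr => j _.
  by rewrite -powR_split ?subr_gt0// /c; ring.
have [//|_ ->] := @Rintegral_lincomb _ _ _ mu _ (size p) c _ _ intf.
rewrite /frac_poly horner_sum mulr_sumr; apply: eq_bigr => j _.
rewrite intE powRD; last first.
  by apply/implyP => _; rewrite gt_eqF// subr_gt0.
rewrite powR_mulrn ?subr_ge0 ?ltW//.
by rewrite hornerZ hornerM horner_exp hornerD hornerN hornerX hornerC /c; ring.
Qed.

End fractional_integral_of_polynomial.

(** * Jacobi polynomials from their recurrence *)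

Local Ltac field_gt0 := field; repeat (apply/andP; split);
  try by []; try (apply: lt0r_neq0; lra).

Lemma gbinom_addn0 (R : realType) (x : R) : gbinom (0%:R + x) 0 = 1.
Proof. by rewrite /gbinom big_ord0 divr1. Qed.

(** The normalization at an endpoint as a first-order recurrence, to be compared
    with the three-term recurrence. *)
Lemma gbinom_addnS (R : realType) (x : R) k :
  gbinom (k.+1%:R + x) k.+1 = gbinom (k%:R + x) k * ((k.+1%:R + x) / k.+1%:R).
Proof.
rewrite /gbinom big_ord_recl subr0 factS natrM invfM.
rewrite (eq_bigr (fun j : 'I_k => k%:R + x - j%:R)); first by ring.
by move=> j _ /=; rewrite /bump add1n -!natr1; ring.
Qed.

Lemma gbinom_addn_gt0 (R : realType) (x : R) k : -1 < x -> 0 < gbinom (k%:R + x) k.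
Proof.
move=> x1; elim: k => [|k IH]; first by rewrite gbinom_addn0.
rewrite gbinom_addnS mulr_gt0// divr_gt0//.
by have := ler0n R k; rewrite -natr1; lra.
Qed.

Section jacobi_polynomials.
Variables (R : realType) (a b : R).

(** The three-term recurrence is taken as the definition; the normalization,
    the orthogonality and the derivative relation are then consequences. *)
Fixpoint jacobi_rec (k : nat) : {poly R} :=
  if k is k1.+1 then
    if k1 is k2.+1 then
      (at_ a b k2.+2 *: 'X - (bt_ a b k2.+2)%:P) * jacobi_rec k1
        - ct_ a b k2.+2 *: jacobi_rec k2
    else ((a + b + 2) / 2) *: 'X + ((a - b) / 2)%:P
  else 1.

(** Locked, since unification would otherwise unfold the recurrence and see a
    sum or a product in every value of the sequence. *)
Definition jacobi_poly : nat -> {poly R} := locked jacobi_rec.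

Local Notation J := jacobi_poly.

Lemma jacobi_poly_recurrence k : J k.+2 =
  (at_ a b k.+2 *: 'X - (bt_ a b k.+2)%:P) * J k.+1 - ct_ a b k.+2 *: J k.
Proof. by rewrite /jacobi_poly -lock. Qed.

Lemma jacobi_poly0 : J 0 = 1. Proof. by rewrite /jacobi_poly -lock. Qed.

Lemma jacobi_poly1 : J 1 = ((a + b + 2) / 2) *: 'X + ((a - b) / 2)%:P.
Proof. by rewrite /jacobi_poly -lock. Qed.

Let J0E (x : R) : (J 0).[x] = 1. Proof. by rewrite jacobi_poly0 hornerC. Qed.

Let dJ0E (x : R) : (J 0)^`().[x] = 0.
Proof. by rewrite jacobi_poly0 derivC horner0. Qed.

Let J1E (x : R) : (J 1).[x] = (a + b + 2) / 2 * x + (a - b) / 2.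
Proof. by rewrite jacobi_poly1 hornerD hornerZ hornerX hornerC. Qed.

Let dJ1E (x : R) : (J 1)^`().[x] = (a + b + 2) / 2.
Proof.
by rewrite jacobi_poly1 derivD derivZ derivX derivC addr0 hornerZ hornerC mulr1.
Qed.

Let JE k (x : R) : (J k.+2).[x] =
  (at_ a b k.+2 * x - bt_ a b k.+2) * (J k.+1).[x] - ct_ a b k.+2 * (J k).[x].
Proof.
by rewrite jacobi_poly_recurrence hornerD hornerN hornerM hornerD hornerN
  !hornerZ hornerX hornerC.
Qed.

Let dJE k (x : R) : (J k.+2)^`().[x] =
  at_ a b k.+2 * (J k.+1).[x] +
  (at_ a b k.+2 * x - bt_ a b k.+2) * (J k.+1)^`().[x] -
  ct_ a b k.+2 * (J k)^`().[x].
Proof.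
rewrite jacobi_poly_recurrence derivB derivM derivB !derivZ derivX derivC subr0.
by rewrite hornerD hornerN hornerD !hornerM !hornerZ hornerD hornerN !hornerZ
  hornerX !hornerC mulr1.
Qed.

Hypotheses (ha : -1 < a) (hb : -1 < b).

Let sab : -2 < a + b. Proof. by move: ha hb; lra. Qed.

Lemma at_gt0 k : 0 < at_ a b k.+2.
Proof.
rewrite /at_; have k0 := ler0n R k; rewrite -2!natr1.
by apply: divr_gt0; apply: mulr_gt0; try (apply: mulr_gt0); move: ha hb; lra.
Qed.

Let divS (s t u : R) : s != 0 -> s * t = u -> t = u / s.
Proof. by move=> s0 <-; rewrite mulrC mulKf. Qed.

(** The lowering relation, which expresses (1 - x^2) P_n' through P_n and
    P_(n-1). It follows by induction on the degree: differentiating the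
    three-term recurrence leaves an identity between rational functions. *)
Lemma jacobi_structure k (x : R) :
  (2 * k.+1%:R + a + b) * ((1 - x ^+ 2) * (J k.+1)^`().[x]) =
  k.+1%:R * (a - b - (2 * k.+1%:R + a + b) * x) * (J k.+1).[x] +
  2 * (k.+1%:R + a) * (k.+1%:R + b) * (J k).[x].
Proof.
elim/ltn_ind: k => -[_|[_|k IH]].
- by rewrite J1E J0E dJ1E; field.
- by rewrite JE dJE J1E J0E dJ1E dJ0E /at_ /bt_ /ct_; have sab' := sab; field_gt0.
have S1 := IH k.+1 (ltnSn _); have S0 := IH k (leqW (ltnSn _)).
have R0 := JE k x; rewrite JE dJE.
have e2 : k.+2%:R = k.+1%:R + 1 :> R by rewrite natr1.
have e3 : k.+3%:R = k.+1%:R + 2 :> R by rewrite -natrD addn2.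
have n1 : 1 <= k.+1%:R :> R by rewrite ler1n.
move: S0 S1 R0; rewrite /at_ /bt_ /ct_ e2 e3 {e2 e3 IH}.
move: (k.+1%:R : R) n1 sab => n n1 s0.
move: (J k).[x] (J k.+1).[x] (J k.+2).[x] (J k.+1)^`().[x] (J k.+2)^`().[x].
move=> p0 p1 p2 d1 d2 S0 S1 R0.
have m1 : 2 * n + a + b != 0 by apply: lt0r_neq0; lra.
have m2 : 2 * (n + 1) + a + b != 0 by apply: lt0r_neq0; lra.
have {}S0 := divS m1 S0; have {}S1 := divS m2 S1.
set A := _ / _; set B := _ * x - _; set C := (n + 2 - 1 + a) * _ * _ / _.
have -> : (1 - x ^+ 2) * (A * p2 + B * d2 - C * d1) =
    (1 - x ^+ 2) * A * p2 + B * ((1 - x ^+ 2) * d2) - C * ((1 - x ^+ 2) * d1).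
  by ring.
by rewrite S0 S1 R0 /B /C /A; field_gt0.
Qed.

(** P_(k+1) is the derivative of a combination of its neighbours. After
    multiplication by 1 - x^2 the derivatives are eliminated by
    [jacobi_structure], which needs degree at least 1; for k = 0 the derivative
    of P_0 occurs, and the relation is computed directly. *)
Lemma jacobi_deriv_relation k :
  J k.+1 = (abar a b k.+2 *: J k + bbar a b k.+2 *: J k.+1 + cbar a b k.+2 *: J k.+2)^`().
Proof.
have sab' := sab.
case: k => [|k].
  apply: poly_eq_horner => x; rewrite J1E !derivD !derivZ !hornerD !hornerZ.
  rewrite dJ0E dJ1E dJE dJ0E J1E dJ1E !mulr0 add0r /at_ /bt_ /ct_ /bbar /cbar.
  by field_gt0.
apply: (@mulfI _ (1 - 'X^2)); first by rewrite -size_poly_gt0 -opprB size_polyN size_XnsubC.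
apply: poly_eq_horner => x.
have R0 := JE k x; have R1 := JE k.+1 x.
have S0 := jacobi_structure k x; have S1 := jacobi_structure k.+1 x.
have S2 := jacobi_structure k.+2 x.
have e2 : k.+2%:R = k.+1%:R + 1 :> R by rewrite natr1.
have e3 : k.+3%:R = k.+1%:R + 2 :> R by rewrite -natrD addn2.
have n1 : 1 <= k.+1%:R :> R by rewrite ler1n.
move: R0 R1 S0 S1 S2; rewrite /at_ /bt_ /ct_ /abar /bbar /cbar e2 e3.
move: (k.+1%:R : R) n1 sab => n n1 s0.
move: (J k) (J k.+1) (J k.+2) (J k.+3) => q0 q1 q2 q3.
rewrite !derivD !derivZ !hornerM !hornerD !hornerZ hornerN hornerXn hornerC.
move: q0.[x] q1.[x] q2.[x] q3.[x] q1^`().[x] q2^`().[x] q3^`().[x].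
move=> p0 p1 p2 p3 d1 d2 d3 R0 R1.
have m1 : 2 * n + a + b != 0 by apply: lt0r_neq0; lra.
have m2 : 2 * (n + 1) + a + b != 0 by apply: lt0r_neq0; lra.
have m3 : 2 * (n + 2) + a + b != 0 by apply: lt0r_neq0; lra.
move=> /(divS m1) S0 /(divS m2) S1 /(divS m3) S2.
rewrite 2!(mulrDr (1 - x ^+ 2)) 3!(mulrCA (1 - x ^+ 2)) S0 S1 S2 R1 R0.
by field_gt0.
Qed.

(** Pearson's operator applied to P_(k+1), expanded on the neighbouring Jacobi
    polynomials. The factor k in the last coefficient removes P_0 when k = 0,
    and this is why the integrals of all P_k with k >= 1 vanish. *)
Lemma jacobi_pearson k :
  (1 - 'X^2) * (J k.+1)^`() + ((b - a)%:P - (a + b + 2) *: 'X) * J k.+1 =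
  (- (k.+1%:R + a + b + 2) / at_ a b k.+2) *: J k.+2
  + (k.+1%:R * (a - b) / (2 * k.+1%:R + a + b) + (b - a)
     - (k.+1%:R + a + b + 2) * bt_ a b k.+2 / at_ a b k.+2) *: J k.+1
  + (k%:R * (2 * (k.+1%:R + a) * (k.+1%:R + b) /
     ((2 * k.+1%:R + a + b) * (2 * k.+1%:R + 1 + a + b)))) *: J k.
Proof.
apply: poly_eq_horner => x; have := JE k x; have := jacobi_structure k x.
have e0 : k%:R = k.+1%:R - 1 :> R by rewrite -natr1 addrK.
have e2 : k.+2%:R = k.+1%:R + 1 :> R by rewrite natr1.
have n1 : 1 <= k.+1%:R :> R by rewrite ler1n.
rewrite /at_ /bt_ /ct_ e0 e2.
move: (k.+1%:R : R) n1 sab => n n1 s0.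
move: (J k) (J k.+1) (J k.+2) => q0 q1 q2.
rewrite !(hornerD, hornerM, hornerN, hornerZ, hornerXn, hornerC, hornerX).
move: q0.[x] q1.[x] q2.[x] q1^`().[x] => p0 p1 p2 d1.
move=> /divS -> => [->|]; last by apply: lt0r_neq0; lra.
field_gt0.
Qed.

Lemma size_jacobi_poly k : size (J k) = k.+1.
Proof.
elim/ltn_ind: k => -[_|[_|k IH]].
- by rewrite jacobi_poly0 size_poly1.
- rewrite jacobi_poly1 -['X]mulr1; apply: size_three_term; rewrite ?size_poly1//.
    by apply: lt0r_neq0; have := sab; lra.
  exact: size_polyC_leq1.
- rewrite jacobi_poly_recurrence mulrBl mul_polyC -scalerAl -addrA.
  have s1 := IH k.+1 (ltnSn _); have s0 := IH k (leqW (ltnSn _)).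
  apply: size_three_term => //; first by rewrite gt_eqF// at_gt0.
  apply: leq_trans (size_polyD _ _) _; rewrite !size_polyN geq_max.
  apply/andP; split; apply: leq_trans (size_scale_leq _ _) _; rewrite ?s1 ?s0//.
Qed.

Lemma jacobi_poly_at1 k : (J k).[1] = gbinom (k%:R + a) k.
Proof.
elim/ltn_ind: k => -[_|[_|k IH]].
- by rewrite J0E gbinom_addn0.
- by rewrite J1E gbinom_addnS gbinom_addn0; field.
rewrite JE (IH k.+1)// (IH k (leqW _))// !gbinom_addnS.
have e0 : k.+1%:R = k%:R + 1 :> R by rewrite natr1.
have e2 : k.+2%:R = k%:R + 2 :> R by rewrite -natrD addn2.
rewrite /at_ /bt_ /ct_ e0 e2; have := ler0n R k.
move: (k%:R : R) (gbinom _ _) sab => n G s0 n0.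
by field_gt0.
Qed.

Lemma jacobi_poly_atN1 k : (J k).[-1] = (-1) ^+ k * gbinom (k%:R + b) k.
Proof.
elim/ltn_ind: k => -[_|[_|k IH]].
- by rewrite J0E gbinom_addn0 mulr1.
- by rewrite J1E gbinom_addnS gbinom_addn0; field.
rewrite JE (IH k.+1)// (IH k (leqW _))// !gbinom_addnS !exprS.
have e0 : k.+1%:R = k%:R + 1 :> R by rewrite natr1.
have e2 : k.+2%:R = k%:R + 2 :> R by rewrite -natrD addn2.
rewrite /at_ /bt_ /ct_ e0 e2; have := ler0n R k.
move: (k%:R : R) (gbinom _ _) ((-1) ^+ k) sab => n G s s0 n0.
by field_gt0.
Qed.

End jacobi_polynomials.

(** * Orthogonality and uniqueness *)

Section jacobi_orthogonality.
Variables (R : realType) (a b : R).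
Hypotheses (ha : -1 < a) (hb : -1 < b).
Local Notation J := (jacobi_poly a b).
Local Notation Phi := (jacobi_int a b).

Let PhiD := jacobi_intD ha hb.
Let PhiZ := jacobi_intZ ha hb.

Let Phi0 : Phi 0 = 0.
Proof. by rewrite -(scale0r (0 : {poly R})) PhiZ mul0r. Qed.

Let PhiB p q : Phi (p - q) = Phi p - Phi q.
Proof. by rewrite -scaleN1r PhiD PhiZ mulN1r. Qed.

(** Pearson's equation for q = P_(k+1) is a linear relation between the
    integrals of P_(k+2), P_(k+1) and P_k in which the first coefficient is
    nonzero. *)
Lemma jacobi_int_jacobi k : Phi (J k.+1) = 0.
Proof.
elim/ltn_ind: k => -[_|k IH].
  have := jacobi_int_pearson ha hb 1.
  rewrite derivC mulr0 add0r mulr1 (_ : _ - _ = (-2) *: J 1).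
    by rewrite PhiZ => /eqP; rewrite mulf_eq0 oppr_eq0 pnatr_eq0/= => /eqP.
  rewrite jacobi_poly1 scalerDr scalerA -mul_polyC -[in RHS]mul_polyC.
  apply: poly_eq_horner => x.
  by rewrite !(hornerD, hornerM, hornerN, hornerZ, hornerC, hornerX); field.
have := jacobi_int_pearson ha hb (J k.+1).
rewrite (jacobi_pearson ha hb) !PhiD !PhiZ (IH k)// mulr0 addr0.
have -> : k%:R * (2 * (k.+1%:R + a) * (k.+1%:R + b) /
     ((2 * k.+1%:R + a + b) * (2 * k.+1%:R + 1 + a + b))) * Phi (J k) = 0 :> R.
  by case: k IH => [_|k ->//]; rewrite ?mul0r ?mulr0.
rewrite addr0 => /eqP; rewrite mulf_eq0 => /orP[|/eqP//].
rewrite mulf_eq0 oppr_eq0 invr_eq0 (gt_eqF (at_gt0 ha hb _)) orbF gt_eqF//.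
by have := ler0n R k; rewrite -natr1; move: ha hb; lra.
Qed.

(** Multiplication by x lowers the index by at most one, so that x^i P_k is a
    combination of P_j with j >= 1. *)
Lemma jacobi_orthogonal_Xn i k : (i < k)%N -> Phi ('X^i * J k) = 0.
Proof.
elim: i k => [|i IH] [|[|k]]//; rewrite ?expr0 ?mul1r; try by move=> _; exact: jacobi_int_jacobi.
rewrite ltnS => ik.
have a0 : at_ a b k.+3 != 0 by rewrite gt_eqF// at_gt0.
have -> : 'X^(i.+1) * J k.+2 = (at_ a b k.+3)^-1 *: ('X^i * J k.+3
    + bt_ a b k.+3 *: ('X^i * J k.+2) + ct_ a b k.+3 *: ('X^i * J k.+1)).
  rewrite (jacobi_poly_recurrence a b k.+1) exprSr.
  apply: poly_eq_horner => x.
  move: (J k.+1) (J k.+2) => p q.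
  by rewrite !(hornerD, hornerM, hornerN, hornerZ, hornerC, hornerX); field.
have ik2 := leqW ik; have ik3 := leqW ik2.
by rewrite PhiZ !PhiD !PhiZ (IH _ ik) (IH _ ik2) (IH _ ik3) !mulr0 !addr0 mulr0.
Qed.

Lemma jacobi_orthogonal k (q : {poly R}) : (size q <= k)%N -> Phi (J k * q) = 0.
Proof.
move=> qk; rewrite -[q]coefK poly_def mulr_sumr.
have : forall i : 'I_(size q), Phi (J k * (q`_i *: 'X^i)) = 0.
  move=> i; rewrite -scalerAr PhiZ mulrC [J k * _]mulrC jacobi_orthogonal_Xn ?mul0r//.
  exact: leq_trans (ltn_ord i) qk.
by move=> H; elim/big_rec: _ => // i p _ IH; rewrite PhiD H IH addr0.
Qed.

(** Subtracting from P the multiple of P_n with the same leading coefficient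
    leaves a polynomial of lower degree that is orthogonal to itself; the factor
    is then read off at 1, where P_n does not vanish. *)
Lemma jacobi_poly_unique n (P : {poly R}) : is_jacobi a b n P -> P = J n.
Proof.
case=> sP orthP P1.
pose c := lead_coef P / lead_coef (J n).
have sJ := size_jacobi_poly ha hb n.
have lJ : lead_coef (J n) != 0 by rewrite lead_coef_eq0 -size_poly_eq0 sJ.
pose q := P - c *: J n.
have sq : (size q <= n)%N.
  apply/leq_sizeP => j; rewrite leq_eqVlt => /predU1P[<-|nj].
    have := erefl (lead_coef P); rewrite /q coefB coefZ.
    rewrite {1}lead_coefE sP/= => ->.
    by rewrite -[(J n)`_n]/((J n)`_n.+1.-1) -sJ -lead_coefE divfK// subrr.
  by rewrite nth_default// (leq_trans _ nj)// (leq_trans (size_polyD _ _))// geq_max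
    sP leqnn size_polyN (leq_trans (size_scale_leq _ _))// sJ.
have q0 : q = 0.
  apply: (jacobi_int_sqr_eq0 ha hb).
  rewrite {1}/q mulrBl PhiB -scalerAl PhiZ (jacobi_orthogonal sq) mulr0 subr0.
  rewrite -[RHS](orthP _ sq); apply: eq_Rintegral => x _.
  by rewrite hornerM.
have PE : P = c *: J n by apply/eqP; rewrite -subr_eq0 -/q q0.
have J1 := jacobi_poly_at1 ha hb n.
have G := gbinom_addn_gt0 n ha.
suff c1 : c = 1 by rewrite PE c1 scale1r.
apply: (@mulIf _ (gbinom (n%:R + a) n)); first by rewrite gt_eqF.
by rewrite mul1r -[RHS]P1 PE hornerZ J1.
Qed.

End jacobi_orthogonality.

(** * Characteristic polynomials from recurrences *)

Section char_poly_recurrence.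
Variables (F : fieldType) (n : nat) (S : 'M[F]_n.+1) (q : nat -> {poly F}) (kappa : F).
Hypothesis q0 : size (q 0%N) = 1%N.
Hypothesis qn : size (q n.+1) = n.+2.
Hypothesis Sq : forall i : 'I_n.+1,
  'X * q i = \sum_j S i j *: q j + (if i == ord_max then kappa *: q n.+1 else 0).

(** With M = 'X - S and v the column of the q i, the hypothesis reads
    M v = (0, ..., 0, kappa q_(n+1)). Multiplying by the adjugate of M gives
    det M * q 0 = h * q_(n+1), where h is kappa times an entry of the adjugate;
    comparing degrees shows that h is a constant, and comparing leading
    coefficients determines it. An argument with eigenvectors would find only
    the distinct zeros of q (n.+1). *)
Lemma char_poly_of_recurrence :
  char_poly S = (lead_coef (q n.+1))^-1 *: q n.+1.
Proof.
pose v : 'cV[{poly F}]_n.+1 := \col_j q j.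
pose e : 'cV[{poly F}]_n.+1 := \col_i (if i == ord_max then kappa *: q n.+1 else 0).
have Mv : char_poly_mx S *m v = e.
  apply/colP => i; rewrite mulmxBl mul_scalar_mx !mxE Sq.
  apply/eqP; rewrite subr_eq addrC; apply/eqP; congr (_ + _).
  by apply: eq_bigr => j _; rewrite !mxE mul_polyC.
have /colP/(_ 0) : char_poly S *: v = \adj (char_poly_mx S) *m e.
  by rewrite -Mv mulmxA mul_adj_mx mul_scalar_mx.
rewrite !mxE (bigD1 ord_max)//= big1 ?addr0; last first.
  by move=> j jn; rewrite !mxE (negbTE jn) mulr0.
rewrite [e _ _]mxE eqxx -scalerAr scalerAl; set h := _ *: _ => E.
have [c c0 qc] : exists2 c, c != 0 & q 0%N = c%:P.
  by move/eqP/size_poly1P: q0.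
have qn0 : q n.+1 != 0 by rewrite -size_poly_gt0 qn.
have h0 : h != 0.
  apply/negP => /eqP h0; move: E; rewrite h0 mul0r qc => /eqP.
  by rewrite mulf_eq0 polyC_eq0 (negbTE c0) orbF (negbTE (monic_neq0 _))// char_poly_monic.
have sh : size h = 1%N.
  have := congr1 (fun p : {poly F} => size p) E.
  rewrite qc mulrC size_Cmul// size_char_poly size_mul// qn addnS/= => /eqP.
  by rewrite -[X in X == _]add1n eqn_add2r => /eqP.
have [d d0 hd] : exists2 d, d != 0 & h = d%:P by move/eqP/size_poly1P: sh.
have {}E : char_poly S = (d / c) *: q n.+1.
  apply: (@mulIf _ c%:P); first by rewrite polyC_eq0.
  rewrite -qc E hd qc mul_polyC -scalerAl -[_ * c%:P]mulrC mul_polyC scalerA.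
  by rewrite divfK.
have : lead_coef (char_poly S) = 1 by apply/monicP/char_poly_monic.
rewrite {1}E lead_coefZ => dl; rewrite E; congr (_ *: _).
by rewrite -[RHS]mul1r -dl mulfK// lead_coef_eq0.
Qed.

End char_poly_recurrence.

(** * Fractional integrals of Jacobi polynomials *)

Section frac_jacobi.
Variables (R : realType) (a b g c : R).
Hypotheses (ha : -1 < a) (hb : -1 < b) (g0 : 0 < g).
Local Notation J := (jacobi_poly a b).

Definition frac_jacobi k : {poly R} := frac_poly c g (J k).

Local Notation Q := frac_jacobi.

Let Q0 : Q 0 = g^-1%:P.
Proof. by rewrite /frac_jacobi jacobi_poly0 frac_poly1. Qed.

(** Value at c of the primitive of P_(k+1) given by [jacobi_deriv_relation]; it
    is the boundary term behind the first column of the matrices. *)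
Definition jacobi_primitive_at k : R :=
  abar a b k.+2 * (J k).[c] + bbar a b k.+2 * (J k.+1).[c]
    + cbar a b k.+2 * (J k.+2).[c].

Let at0 k : at_ a b k.+2 != 0.
Proof. by rewrite gt_eqF// at_gt0. Qed.

(* The product at_ k * cbar k simplifies to 1 / k. *)
Let den0 k : 1 + g * at_ a b k.+2 * cbar a b k.+2 != 0.
Proof.
have k0 := ler0n R k.
have -> : 1 + g * at_ a b k.+2 * cbar a b k.+2 = 1 + g / k.+2%:R.
  rewrite /at_ /cbar -[k.+2]addn2 natrD; field.
  by repeat (apply/andP; split); apply: lt0r_neq0; move: ha hb; lra.
by rewrite gt_eqF// ltr_wpDr// divr_ge0// ltW.
Qed.

Let A1_neq0 k : A1 a b g k.+2 != 0.
Proof. by rewrite mulf_neq0 ?invr_eq0. Qed.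

(** First row of the matrices: the commutation rule for F = 'X, where P_1 is
    affine in 'X. *)
Lemma frac_jacobi_mulX0 : 'X * Q 0 =
  ((1 + g) * (b - a) / (a + b + 2) - c * g) *: Q 0
  + (2 * (1 + g) / (a + b + 2)) *: Q 1.
Proof.
have := frac_poly_mulX_deriv c g0 'X.
rewrite derivX mulr1 frac_poly1 hornerX => T1.
have Q1 : Q 1 = ((a + b + 2) / 2) *: frac_poly c g 'X + ((a - b) / 2) *: Q 0.
  by rewrite /frac_jacobi jacobi_poly1 -alg_polyC linearP linearZ jacobi_poly0.
rewrite Q1 Q0; apply: poly_eq_horner => x.
move/(congr1 (horner^~ x)) : T1.
move: (frac_poly c g 'X) => T.
rewrite !(hornerD, hornerM, hornerN, hornerZ, hornerC, hornerX).
move: T.[x] => y E; have g1 : 1 + g != 0 by apply: lt0r_neq0; move: g0; lra.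
have Tx : (1 + g) * y = x / g + c by rewrite mulrDl mul1r {1}E subrK.
have {Tx E} -> : y = (x / g + c) / (1 + g) by rewrite -Tx mulrAC divff// mul1r.
field.
by rewrite g1 /=; repeat (apply/andP; split); apply: lt0r_neq0; move: ha hb g0; lra.
Qed.

(** The other rows. The operator is applied to the three-term recurrence; the
    term with x P_(k+1) is commuted past the operator, using that P_(k+1) is the
    derivative of the primitive F. This produces Q_(k+2) on both sides, hence
    the common denominator 1 + g at_ cbar, and the constant F(c), which is
    F(c) g Q_0 because Q_0 = 1 / g. *)
Lemma frac_jacobi_recurrence k : 'X * Q k.+1 =
  (1 / A1 a b g k.+2) *: Q k.+2 + (A2 a b g k.+2 / A1 a b g k.+2) *: Q k.+1
  + (A3 a b g k.+2 / A1 a b g k.+2) *: Q k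
  - ((g * at_ a b k.+2 * jacobi_primitive_at k /
      (1 + g * at_ a b k.+2 * cbar a b k.+2)) / A1 a b g k.+2) *: Q 0.
Proof.
set F := abar a b k.+2 *: J k + bbar a b k.+2 *: J k.+1 + cbar a b k.+2 *: J k.+2.
have F' : J k.+1 = F^`() by exact: jacobi_deriv_relation.
have Fc : F.[c] = jacobi_primitive_at k by rewrite /F !hornerD !hornerZ.
have QF : frac_poly c g F =
    abar a b k.+2 *: Q k + bbar a b k.+2 *: Q k.+1 + cbar a b k.+2 *: Q k.+2.
  by rewrite /F !linearD !linearZ.
have QX : frac_poly c g ('X * J k.+1) =
    'X * Q k.+1 + (jacobi_primitive_at k)%:P - g *: frac_poly c g F.
  by rewrite -Fc /frac_jacobi F' frac_poly_mulX_deriv.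
have Qk : Q k.+2 = at_ a b k.+2 *: frac_poly c g ('X * J k.+1)
    - bt_ a b k.+2 *: Q k.+1 - ct_ a b k.+2 *: Q k.
  rewrite {1}/frac_jacobi jacobi_poly_recurrence mulrBl mul_polyC -scalerAl.
  by rewrite !linearB !linearZ.
rewrite QX QF in Qk; rewrite Q0; apply: poly_eq_horner => x.
move/(congr1 (horner^~ x)) : Qk.
move: (Q k) (Q k.+1) (Q k.+2) => q0 q1 q2.
rewrite !(hornerD, hornerM, hornerN, hornerZ, hornerC, hornerX).
move: q0.[x] q1.[x] q2.[x] => y0 y1 y2 E.
have {}E : x * y1 = (y2 + bt_ a b k.+2 * y1 + ct_ a b k.+2 * y0) / at_ a b k.+2
    - jacobi_primitive_at k
    + g * (abar a b k.+2 * y0 + bbar a b k.+2 * y1 + cbar a b k.+2 * y2).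
  by rewrite {1}E; field.
have g0' : g != 0 by rewrite gt_eqF.
rewrite E /A1 /A2 /A3; field.
by rewrite g0' at0 den0.
Qed.

Lemma size_frac_jacobi k : size (Q k) = k.+1.
Proof.
elim/ltn_ind: k => -[_|[_|k IH]].
- by rewrite Q0 size_polyC invr_eq0 gt_eqF.
- have s0 : a + b + 2 != 0 by apply: lt0r_neq0; move: ha hb; lra.
  have g1 : 1 + g != 0 by apply: lt0r_neq0; move: g0; lra.
  have e : (2 * (1 + g) / (a + b + 2))^-1 != 0.
    by rewrite invr_eq0 !mulf_neq0 ?invr_eq0 ?pnatr_eq0.
  have -> : Q 1 = (2 * (1 + g) / (a + b + 2))^-1 *: ('X * Q 0) +
     (- (2 * (1 + g) / (a + b + 2))^-1 *
       ((1 + g) * (b - a) / (a + b + 2) - c * g)) *: Q 0.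
    rewrite frac_jacobi_mulX0 scalerDr !scalerA mulVf ?scale1r; last by rewrite -invr_eq0.
    by rewrite addrAC -scalerDl mulNr subrr scale0r add0r.
  have s : size (Q 0) = 1%N by rewrite Q0 size_polyC invr_eq0 gt_eqF.
  apply: size_three_term => //.
  by apply: leq_trans (size_scale_leq _ _) _; rewrite s.
- have s1 := IH k.+1 (ltnSn _); have s0 := IH k (leqW (ltnSn _)).
  have s : size (Q 0) = 1%N by rewrite Q0 size_polyC invr_eq0 gt_eqF.
  have := frac_jacobi_recurrence k; set u := _ *: Q k.+1; set v := _ *: Q k.
  set w := _ *: Q 0 => E.
  have -> : Q k.+2 = A1 a b g k.+2 *: ('X * Q k.+1) + A1 a b g k.+2 *: (w - u - v).
    rewrite -scalerDr E [_ + (w - u - v)](_ : _ = (1 / A1 a b g k.+2) *: Q k.+2).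
      by rewrite scalerA mulrC divfK// scale1r.
    by ring.
  apply: size_three_term => //.
  apply: leq_trans (size_scale_leq _ _) _.
  apply: leq_trans (size_polyD _ _) _; rewrite size_polyN geq_max; apply/andP; split.
    apply: leq_trans (size_polyD _ _) _; rewrite size_polyN geq_max; apply/andP; split.
      by apply: leq_trans (size_scale_leq _ _) _; rewrite s.
    by apply: leq_trans (size_scale_leq _ _) _; rewrite s1.
  by apply: leq_trans (size_scale_leq _ _) _; rewrite s0.
Qed.

End frac_jacobi.

(** * The rows of the matrices *)

Section hessenberg_rows.
Variables (R : realType) (a b g c : R).
Hypotheses (ha : -1 < a) (hb : -1 < b) (g0 : 0 < g).
Variables (s11 : R) (A4 : nat -> R).
Hypothesis s11E : s11 = (1 + g) * (b - a) / (a + b + 2) - c * g.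
Hypothesis A4E : forall k, A4 k.+2 =
  g * at_ a b k.+2 * jacobi_primitive_at a b c k /
      (1 + g * at_ a b k.+2 * cbar a b k.+2).
Local Notation Q := (frac_jacobi a b g c).
Local Notation s i j := (S_entry a b g s11 A4 i.+1 j.+1).

Let sum_delta (n m : nat) (x : R) : (m < n)%N ->
  \sum_(j < n) (x * (j == m :> nat)%:R) *: Q j = x *: Q m.
Proof.
move=> mn; rewrite (bigD1 (Ordinal mn))//= eqxx mulr1 big1 ?addr0// => j jm.
by rewrite (_ : (_ == _) = false) ?mulr0 ?scale0r//; apply: negbTE.
Qed.

Let S_entry0 j : s 0 j =
  s11 * (j == 0)%:R + (2 * (1 + g) / (a + b + 2)) * (j == 1)%:R.
Proof.
by rewrite /S_entry; case: j => [|[|j]]/=; rewrite ?mulr1 ?mulr0 ?addr0 ?add0r.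
Qed.

Let S_entryS k j : s k.+1 j =
  (1 / A1 a b g k.+2) * (j == k.+2)%:R
  + (A2 a b g k.+2 / A1 a b g k.+2) * (j == k.+1)%:R
  + (A3 a b g k.+2 / A1 a b g k.+2) * (j == k)%:R
  - (A4 k.+2 / A1 a b g k.+2) * (j == 0)%:R.
Proof.
rewrite /S_entry; case: j => [|j] /=.
  by case: k => [|k] /=; rewrite ?mulr1 ?mulr0 ?add0r ?sub0r// mulrBl.
rewrite !eqSS (eq_sym k) mulr0 subr0.
have [->|jk] := eqVneq j k.
  by rewrite (ltn_eqF (ltnSn k)) (gtn_eqF (ltnSn k)) !mulr0 mulr1 add0r addr0.
have [->|jk1] := eqVneq j k.+1.
  by rewrite (gtn_eqF (leqnSn k.+1)) !mulr0 mulr1 !addr0.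
by case: eqP => _; rewrite ?mulr0 ?mulr1 ?add0r.
Qed.

Lemma frac_jacobi_row n i : (i < n)%N ->
  'X * Q i = \sum_(j < n.+1) s i j *: Q j.
Proof.
case: i => [|k] lin.
  rewrite frac_jacobi_mulX0// -s11E.
  under eq_bigr do rewrite S_entry0 scalerDl.
  by rewrite big_split/= !sum_delta.
rewrite frac_jacobi_recurrence// -A4E.
under eq_bigr do rewrite S_entryS !scalerDl scaleNr.
by rewrite !big_split/= sumrN !sum_delta// ?ltnS// ?(ltnW lin)// ltnW// ltnW.
Qed.

(** The only entry to the right of the n.+1 columns kept in the matrix is the
    superdiagonal one of the last row; it plays the part of kappa. *)
Lemma char_poly_S_entry n :
  char_poly (\matrix_(i < n.+1, j < n.+1) s i j) = (lead_coef (Q n.+1))^-1 *: Q n.+1.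
Proof.
apply: (@char_poly_of_recurrence _ _ _ Q (s n n.+1)).
- exact: size_frac_jacobi.
- exact: size_frac_jacobi.
move=> i; rewrite (frac_jacobi_row (ltn_ord i)) big_ord_recr/=; congr (_ + _).
  by apply: eq_bigr => j _; rewrite mxE.
case: (eqVneq i ord_max) => [->//|im].
have lin : (i < n)%N by rewrite ltn_neqAle -ltnS ltn_ord andbT.
case: (nat_of_ord i) lin => [|k] lin.
  have n1 : (n.+1 == 1)%N = false by rewrite eqSS gtn_eqF.
  by rewrite S_entry0 n1 !mulr0 addr0 scale0r.
by rewrite S_entryS !gtn_eqF ?mulr0 ?addr0 ?subr0 ?scale0r// ltnS ltnW// ltnW.
Qed.
End hessenberg_rows.

Lemma zero_list_char_poly (R : realType) n (S : 'M[R]_n) (p : {poly R})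
    (xi : n.-tuple R[i]) :
  p != 0 -> char_poly S = (lead_coef p)^-1 *: p -> zero_list p xi ->
  (forall i : 'I_n, eigenvalue (map_mx (real_complex R) S) (tnth xi i)) /\
  char_poly (map_mx (real_complex R) S) = \prod_(z <- xi) ('X - z%:P).
Proof.
move=> p0 Sp pxi; have cp : char_poly (map_mx (real_complex R) S) =
    \prod_(z <- xi) ('X - z%:P).
  rewrite -map_char_poly Sp map_polyZ pxi scalerA -rmorphM mulVf ?rmorph1 ?scale1r//.
  by rewrite lead_coef_eq0.
split=> // i; rewrite eigenvalue_root_char cp root_prod_XsubC; exact: mem_tnth.
Qed.

Section endpoint_coefficients.
Variables (R : realType) (a b g : R).
Hypotheses (ha : -1 < a) (hb : -1 < b).

Let subn2 k : k.+2%:R - 2 = k%:R :> R.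
Proof. by rewrite -[k.+2]addn2 natrD addrK. Qed.

Let subn1 k : k.+2%:R - 1 = k.+1%:R :> R.
Proof. by rewrite -natr1 addrK. Qed.

Lemma AL4_primitive k : AL4 a b g k.+2 =
  g * at_ a b k.+2 * jacobi_primitive_at a b (-1) k /
  (1 + g * at_ a b k.+2 * cbar a b k.+2).
Proof.
rewrite /AL4 /jacobi_primitive_at /dL1 /dL2 /dL3 !jacobi_poly_atN1// subn2 subn1.
by rewrite !subSS !subn0 !exprS !mulN1r opprK.
Qed.

Lemma AR4_primitive k : AR4 a b g k.+2 =
  g * at_ a b k.+2 * jacobi_primitive_at a b 1 k /
  (1 + g * at_ a b k.+2 * cbar a b k.+2).
Proof.
rewrite /AR4 /jacobi_primitive_at /dR1 /dR2 /dR3 !jacobi_poly_at1// subn2 subn1.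
by rewrite !subSS !subn0.
Qed.

End endpoint_coefficients.

Theorem theorem4p5 (R : realType) (n : nat) (g a b : R) (P : {poly R}) :
  (1 <= n)%N -> 0 < g < 1 -> -1 < a -> -1 < b -> a + b != -1 ->
  is_jacobi a b n P ->
  (exists pL : {poly R},
    [/\ size pL = n.+1,
        forall x : R, -1 < x <= 1 ->
          pL.[x] = (1 + x) `^ (- g) * frac_int_left g (horner P) x
      & forall xi : n.-tuple R[i], zero_list pL xi ->
          (forall i : 'I_n,
             eigenvalue (map_mx (real_complex R) (S_L a b g n)) (tnth xi i)) /\
          char_poly (map_mx (real_complex R) (S_L a b g n)) =
            \prod_(z <- xi) ('X - z%:P)]) /\
  (exists pR : {poly R},
    [/\ size pR = n.+1,
        forall x : R, -1 <= x < 1 ->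
          pR.[x] = (1 - x) `^ (- g) * frac_int_right g (horner P) x
      & forall xi : n.-tuple R[i], zero_list pR xi ->
          (forall i : 'I_n,
             eigenvalue (map_mx (real_complex R) (S_R a b g n)) (tnth xi i)) /\
          char_poly (map_mx (real_complex R) (S_R a b g n)) =
            \prod_(z <- xi) ('X - z%:P)]).
Proof.
move=> n1 /andP[g0 g1] ha hb _ /(jacobi_poly_unique ha hb) ->.
case: n n1 => // n _.
have G0 : Gamma g != 0 by rewrite Gamma_neq0// g0 ltW.
have G0' : (Gamma g)^-1 != 0 by rewrite invr_eq0.
have s0 : a + b + 2 != 0 by apply: lt0r_neq0; lra.
have cancel (y z : R) : 0 < y -> y `^ (- g) * ((Gamma g)^-1 * (y `^ g * z)) = (Gamma g)^-1 * z.
  by move=> y0; rewrite powRN mulrCA mulKf// gt_eqF ?powR_gt0.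
have char_scale (S : 'M[R]_n.+1) (q : {poly R}) : char_poly S = (lead_coef q)^-1 *: q ->
    char_poly S = (lead_coef ((Gamma g)^-1 *: q))^-1 *: ((Gamma g)^-1 *: q).
  by move=> ->; rewrite lead_coefZ scalerA invfM mulrC mulrA divff// mul1r.
have size_Q c := size_frac_jacobi c ha hb g0 n.+1.
have Q_neq0 c : (Gamma g)^-1 *: frac_jacobi a b g c n.+1 != 0.
  by rewrite scaler_eq0 negb_or G0' -size_poly_eq0 size_Q.
split.
- exists ((Gamma g)^-1 *: frac_jacobi a b g (-1) n.+1); split.
  + by rewrite size_scale ?size_Q.
  + move=> x /andP[x1 _]; rewrite frac_int_left_poly// cancel ?hornerZ//.
    by lra.
  + move=> xi; apply: zero_list_char_poly; [exact: Q_neq0 | apply: char_scale].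
    rewrite /S_L; apply: char_poly_S_entry => //; last exact: AL4_primitive.
    by field.
- exists ((Gamma g)^-1 *: frac_jacobi a b g 1 n.+1); split.
  + by rewrite size_scale ?size_Q.
  + move=> x /andP[_ x1]; rewrite frac_int_right_poly// cancel ?hornerZ//.
    by lra.
  + move=> xi; apply: zero_list_char_poly; [exact: Q_neq0 | apply: char_scale].
    rewrite /S_R; apply: char_poly_S_entry => //; last exact: AR4_primitive.
    by field.
Qed.
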